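(* Let $S$ be an infinite set and let $A\in(\mathbb{R}\cup\{-\infty\})^{S\times S}$ be such that $\rho(A)\in\mathbb{R}$. Let $\lambda\in\mathbb{R}$ be such that $\lambda\ge\rho(A)$, and let $i\in S$. Then the vector $u:=(A_\lambda)^*_{\cdot i}$ (the $i$-th column of $(A_\lambda)^*$) satisfies $(Au)_k=\lambda+u_k$ for all $k\in S$ if and only if $i$ is a recurrent node of $A$ and $\lambda=\rho(A)$. In particular, if there are only finitely many paths between any two distinct nodes of the multigraph of strongly connected components of $A$, then $\tilde A^*_{\cdot i}$ is a $\rho(A)$-eigenvector of $A$ if and only if $i$ is recurrent.
   Context: Write $\overline{\mathbb{R}}=\mathbb{R}\cup\{-\infty,+\infty\}$, with the convention $(-\infty)+(+\infty)=-\infty$; the supremum of the empty set is $-\infty$. For $B,C\in\overline{\mathbb{R}}^{S\times S}$ and $u\in\overline{\mathbb{R}}^S$, $(BC)_{ij}=\sup_{k\in S}(B_{ik}+C_{kj})$ and $(Bu)_i=\sup_{k\in S}(B_{ik}+u_k)$; $B^0=I$ is the matrix with $0$ on the diagonal and $-\infty$ elsewhere, $B^n$ is the $n$-th power, $B^+_{ij}:=\sup_{n\ge1}(B^n)_{ij}$, $B^*_{ij}:=\sup_{n\ge0}(B^n)_{ij}$. The maximal circuit mean is $\rho(A):=\sup_{k\ge1}\sup_{i\in S}\frac1k (A^k)_{ii}$. For $\lambda\in\mathbb{R}$, $A_\lambda$ is the matrix $(A_\lambda)_{ij}:=A_{ij}-\lambda$, and $\tilde A:=A_{\rho(A)}$.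 A node $i\in S$ is recurrent if $\tilde A^+_{ii}=0$. A $\lambda$-eigenvector of $A$ is a vector $u\in(\mathbb{R}\cup\{-\infty\})^S$, not identically $-\infty$, such that $(Au)_k=\lambda+u_k$ for all $k\in S$. $G(A)$ is the digraph with node set $S$ and an arc $i\to j$ whenever $A_{ij}\ne-\infty$. The multigraph of strongly connected components of $A$ has as nodes the strongly connected components of $G(A)$ and, for any two distinct components $C,C'$, as many arcs from $C$ to $C'$ as there are arcs $i\to j$ in $G(A)$ with $i\in C$, $j\in C'$. *)

(* Defs.v *)
From mathcomp Require Import all_boot all_order all_algebra.
From mathcomp Require Import all_classical all_reals all_analysis.

Set Implicit Arguments.
Unset Strict Implicit.
Unset Printing Implicit Defensive.

Import Order.TTheory GRing.Theory Num.Theory.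

Local Open Scope classical_set_scope.
Local Open Scope ring_scope.
Local Open Scope ereal_scope.

(* Max-plus algebra over [\bar R]: the library addition [+%E] satisfies
   -oo + +oo = -oo, and [ereal_sup set0 = -oo], as required here. *)

Section MaxPlus.
Context {R : realType} {S : Type}.
Implicit Types (A B : S -> S -> \bar R) (C : set S) (u : S -> \bar R).

Definition mpmul (B C : S -> S -> \bar R) : S -> S -> \bar R :=
  fun i j => ereal_sup [set B i k + C k j | k in [set: S]].

Definition mpapp B u : S -> \bar R :=
  fun i => ereal_sup [set B i k + u k | k in [set: S]].

Definition mpid : S -> S -> \bar R :=
  fun i j => if `[< i = j >] then 0 else -oo.

Definition mppow B (n : nat) : S -> S -> \bar R := iter n (mpmul B) mpid.

Definition mpplus B : S -> S -> \bar R :=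
  fun i j => ereal_sup [set mppow B n i j | n in [set n | (0 < n)%N]].

Definition mpstar B : S -> S -> \bar R :=
  fun i j => ereal_sup [set mppow B n i j | n in [set: nat]].

Definition max_circuit_mean A : \bar R :=
  ereal_sup [set ereal_sup [set (k%:R^-1)%:E * mppow A k i i | i in [set: S]]
            | k in [set k | (0 < k)%N]].

Definition mpshift A (lambda : R) : S -> S -> \bar R :=
  fun i j => A i j - lambda%:E.

(* [fine] is only meaningful when [max_circuit_mean A] is finite; it sends
   infinite values to 0. *)
Definition mptilde A : S -> S -> \bar R :=
  mpshift A (fine (max_circuit_mean A)).

Definition recurrent A (i : S) : Prop := mpplus (mptilde A) i i = 0.

Definition mpeigenvector A (lambda : R) u : Prop :=
  [/\ forall k, u k != +oo,
      exists k, u k != -oo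
    & forall k, mpapp A u k = lambda%:E + u k].

Definition arc A : rel S := fun i j => A i j != -oo.

Definition reach A (i j : S) : Prop :=
  exists p : seq S, path (arc A) i p /\ last i p = j.

Definition scc_of A (i : S) : set S := [set j | reach A i j /\ reach A j i].

Definition is_scc A C : Prop := exists i, C = scc_of A i.

(* The arcs of the multigraph of components are the arcs (i, j) of the digraph
   joining distinct components; parallel arcs are thus kept apart. *)
Definition scc_arc A C C' (a : S * S) : Prop :=
  [/\ C <> C', C a.1, C' a.2 & arc A a.1 a.2].

(* A path is given by its sequence of arcs. No condition that nodes be distinct
   is imposed: the multigraph has no circuit, so it would hold automatically. *)
Fixpoint scc_path A C (p : seq (S * S)) C' : Prop :=
  match p with
  | [::] => C = C'
  | a :: q => exists D, [/\ is_scc A D, scc_arc A C D a & scc_path A D q C']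
  end.

Definition finitely_many_scc_paths A : Prop :=
  forall C C', is_scc A C -> is_scc A C' -> C <> C' ->
    finite_set [set p | scc_path A C p C'].

End MaxPlus.

(* Main.v *)
Require Import Defs.
From mathcomp Require Import all_boot all_order all_algebra.
From mathcomp Require Import all_classical all_reals all_analysis.

(** With B := A_lambda, one has B B^* = B^+ and B^* = max(I, B^+), so the i-th
    column of B^* is fixed by B if and only if B^+_ii >= 0.  Since
    (B^n)_ii <= n (rho(A) - lambda), this forces lambda = rho(A) and
    B^+_ii = 0.
    For the second part only u < +oo is at stake.  If k and i lie in the same
    component, a path back from i to k of weight c > -oo bounds B^*_ki by -c.
    Otherwise, every path from k to i is cut by its arcs joining distinct
    components into pieces that each stay in one component; B^*_ki is thus
    bounded by the largest of the weights [scc_path_weight] of the finitely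
    many paths of the multigraph of components. *)

Set Implicit Arguments.
Unset Strict Implicit.
Unset Printing Implicit Defensive.

Import Order.TTheory GRing.Theory Num.Theory.

Local Open Scope classical_set_scope.
Local Open Scope ring_scope.
Local Open Scope ereal_scope.

(** * Suprema and uniform bounds in the extended reals *)

Section ExtendedReals.
Context {R : realType} {T : Type}.
Implicit Types (D : set T) (f : T -> \bar R) (c : \bar R).

(* No finiteness of [c] is needed, thanks to the convention -oo + +oo = -oo. *)
Lemma ereal_supDr D f c :
  ereal_sup [set f k + c | k in D] = ereal_sup [set f k | k in D] + c.
Proof.
apply/eqP; rewrite eq_le; apply/andP; split.
  apply/ereal_supP => _ [k Dk <-]; rewrite leeD2r//.
  by apply: ereal_sup_ubound; exists k.
case: c => [r| |].
- rewrite -leeBrDr//; apply/ereal_supP => _ [k Dk <-]; rewrite leeBrDr//.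
  by apply: ereal_sup_ubound; exists k.
(* For [c = +oo]: if every [f k] is [-oo], both sides are [-oo] by the convention; otherwise one
   term on the left is already [+oo]. *)
- have [fNy|/existsNP[k /not_implyP[Dk /eqP fk]]] :=
    pselect (forall k, D k -> f k = -oo).
    have -> : ereal_sup [set f k | k in D] = -oo.
      apply/eqP; rewrite -leeNy_eq; apply/ereal_supP => _ [k Dk <-].
      by rewrite fNy.
    by rewrite addNye leNye.
  apply: le_trans (leey _) _.
  by apply: ereal_sup_ubound; exists k => //; rewrite addey.
- by rewrite addeNy leNye.
Qed.

Lemma ereal_supDl D f c :
  ereal_sup [set c + f k | k in D] = c + ereal_sup [set f k | k in D].
Proof.
rewrite addeC -ereal_supDr; congr ereal_sup.
by apply: eq_imagel => k _; rewrite addeC.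
Qed.

Lemma finite_set_lty_bounded D f : finite_set D ->
  (forall k, D k -> f k < +oo) -> exists M : R, forall k, D k -> f k <= M%:E.
Proof.
move=> /(finite_image f) /finite_seqP[s fDs] fD.
have {fD} slty : forall x, x \in s -> x < +oo.
  move=> x xs; have : [set` s] x by [].
  by rewrite -fDs => -[k Dk <-]; exact: fD.
suff [M sM] : exists M : R, forall x, x \in s -> x <= M%:E.
  exists M => k Dk; apply: sM.
  by have : (f @` D) (f k) by [exists k]; rewrite fDs.
elim: s slty {fDs} => [|x s IHs] slty; first by exists 0%R.
have [y ys|M sM] := IHs; first by apply: slty; rewrite in_cons ys orbT.
have [N xN] : exists N : R, x <= N%:E.
  have := slty x (mem_head _ _); case: x {slty} => [r|//|] _.
    by exists r.
  by exists 0%R; rewrite leNye.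
exists (Num.max M N) => y; rewrite in_cons => /orP[/eqP ->|/sM yM].
  by rewrite (le_trans xN)// lee_fin le_max lexx orbT.
by rewrite (le_trans yM)// lee_fin le_max lexx.
Qed.

End ExtendedReals.

(** * Max-plus powers, their suprema, and the shift by a constant *)

Section MaxPlusAlgebra.
Context {R : realType} {S : Type}.
Implicit Types (A B : S -> S -> \bar R) (u : S -> \bar R) (l : R).

Lemma mppowS B n i j :
  mppow B n.+1 i j = ereal_sup [set B i k + mppow B n k j | k in [set: S]].
Proof. by []. Qed.

Lemma mpid_refl (i : S) : mpid i i = 0 :> \bar R.
Proof. by rewrite /mpid; case: asboolP. Qed.

Lemma mpid_neq (i j : S) : i <> j -> mpid i j = -oo :> \bar R.
Proof. by rewrite /mpid; case: asboolP. Qed.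

Lemma mppow_le_mpstar B n i j : mppow B n i j <= mpstar B i j.
Proof. by apply: ereal_sup_ubound; exists n. Qed.

Lemma mppowS_ge B n i k j : B i k + mppow B n k j <= mppow B n.+1 i j.
Proof. by rewrite mppowS; apply: ereal_sup_ubound; exists k. Qed.

(** Concatenation at [k] of a path of length [n] and one of length [m]. It serves to close a path
    into a circuit. *)
Lemma mppowD_ge B n m i k j :
  mppow B n i k + mppow B m k j <= mppow B (n + m) i j.
Proof.
elim: n i => [|n IHn] i.
  have [->|ik] := pselect (i = k); first by rewrite [mppow B 0]/= mpid_refl add0e.
  by rewrite [mppow B 0]/= mpid_neq// addNye leNye.
rewrite mppowS -ereal_supDr; apply/ereal_supP => _ [l _ <-].
by rewrite -addeA (le_trans (leeD2l _ (IHn l)))// addSn mppowS_ge.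
Qed.

Lemma mpstar_refl_ge0 B i : 0 <= mpstar B i i.
Proof. by rewrite -(mpid_refl i) (mppow_le_mpstar B 0). Qed.

Lemma mpstarE B i j : mpstar B i j = maxe (mpid i j) (mpplus B i j).
Proof.
apply/eqP; rewrite eq_le; apply/andP; split.
  apply/ereal_supP => _ [[|n] _ <-]; first by rewrite le_max lexx.
  by rewrite le_max; apply/orP; right; apply: ereal_sup_ubound; exists n.+1.
rewrite ge_max (mppow_le_mpstar B 0)/=.
by apply/ereal_supP => _ [n _ <-]; exact: mppow_le_mpstar.
Qed.

Lemma mpapp_mpstar B i k : mpapp B (fun j => mpstar B j i) k = mpplus B k i.
Proof.
apply/eqP; rewrite eq_le; apply/andP; split.
  apply/ereal_supP => _ [j _ <-]; rewrite -ereal_supDl.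
  apply/ereal_supP => _ [n _ <-]; rewrite (le_trans (mppowS_ge _ _ _ _ _))//.
  by apply: ereal_sup_ubound; exists n.+1.
apply/ereal_supP => _ [[//|n] _ <-]; rewrite mppowS.
apply/ereal_supP => _ [j _ <-].
rewrite (le_trans (leeD2l _ (mppow_le_mpstar _ _ _ _)))//.
by apply: ereal_sup_ubound; exists j.
Qed.

Lemma mpstar_arc_le B i k j : B i k + mpstar B k j <= mpstar B i j.
Proof.
rewrite [leRHS]mpstarE -mpapp_mpstar le_max; apply/orP; right.
by apply: ereal_sup_ubound; exists k.
Qed.

(** Rows other than [i] impose nothing: the identity is [-oo] there, so [B^+] and [B^*] agree. Row
    [i] reads [B^+_ii = max(0, B^+_ii)]. *)
Lemma mpstar_column_fixedP B i :
  (forall k, mpapp B (fun j => mpstar B j i) k = mpstar B k i) <->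
  0 <= mpplus B i i.
Proof.
split=> [/(_ i)|Bii k]; rewrite mpapp_mpstar.
  by move=> ->; exact: mpstar_refl_ge0.
rewrite mpstarE; have [->|ki] := pselect (k = i).
  by rewrite mpid_refl max_r.
by rewrite mpid_neq// max_r// leNye.
Qed.

Lemma mpapp_mpshift A l u k : mpapp (mpshift A l) u k = mpapp A u k - l%:E.
Proof.
rewrite -ereal_supDr; congr ereal_sup.
by apply: eq_imagel => j _; rewrite addeAC.
Qed.

Lemma mppow_mpshift A l n i j :
  mppow (mpshift A l) n i j = mppow A n i j - (l *+ n)%:E.
Proof.
elim: n i => [|n IHn] i; first by rewrite mulr0n sube0.
rewrite !mppowS -ereal_supDr; congr ereal_sup; apply: eq_imagel => k _.
by rewrite IHn /mpshift mulrS EFinD fin_num_oppeD// addeACA.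
Qed.

Lemma arc_mpshift A l : Defs.arc (mpshift A l) = Defs.arc A.
Proof.
apply/funext => i; apply/funext => j.
by rewrite /Defs.arc /mpshift; case: (A i j).
Qed.

Lemma mppow_diag_le A (r : R) n i : max_circuit_mean A = r%:E ->
  mppow A n i i <= (r *+ n)%:E.
Proof.
move=> Ar; case: n => [|n]; first by rewrite [mppow A 0]/= mpid_refl.
rewrite -mulr_natl EFinM -lee_pdivrMl// -Ar.
apply: (@le_trans _ _ (ereal_sup
  [set (n.+1%:R^-1)%:E * mppow A n.+1 k k | k in [set: S]])).
  by apply: ereal_sup_ubound; exists i.
by apply: ereal_sup_ubound; exists n.+1.
Qed.

Lemma mppow_mpshift_diag_le A (r l : R) n i : max_circuit_mean A = r%:E ->
  mppow (mpshift A l) n i i <= ((r - l) *+ n)%:E.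
Proof.
move=> Ar; rewrite mppow_mpshift mulrnBl EFinB leeB//.
exact: mppow_diag_le.
Qed.

Lemma mpplus_mpshift_ge0P A (r l : R) i : max_circuit_mean A = r%:E ->
  (r <= l)%R ->
  0 <= mpplus (mpshift A l) i i <-> recurrent A i /\ l%:E = max_circuit_mean A.
Proof.
move=> Ar rl; rewrite /recurrent /mptilde Ar /=.
(* As [r - l] is at most 0, its multiples by [n >= 1] are at most [r - l] itself, which gives a
   bound uniform in [n]. *)
have le_rl : mpplus (mpshift A l) i i <= (r - l)%:E.
  apply/ereal_supP => _ [[//|n] _ <-].
  rewrite (le_trans (mppow_mpshift_diag_le _ _ _ Ar))// lee_fin.
  by rewrite mulrS gerDl mulrn_wle0// subr_le0.
split=> [Bii|[Bii [->]]]; last by rewrite Bii.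
have lr : l = r.
  by apply: le_anti; rewrite rl andbT -subr_ge0 -lee_fin (le_trans Bii).
move: le_rl Bii; rewrite lr subrr => le0 ge0.
by split=> //; apply: le_anti; rewrite le0 ge0.
Qed.

End MaxPlusAlgebra.

(** * Finiteness of [B^*] through strongly connected components *)

Section Components.
Context {R : realType} {S : Type} (A : S -> S -> \bar R).

Lemma reach_refl i : reach A i i.
Proof. by exists [::]. Qed.

Lemma reach_trans i j k : reach A i j -> reach A j k -> reach A i k.
Proof.
move=> [p [ip pj]] [q [jq qk]]; exists (p ++ q).
by rewrite cat_path last_cat pj ip jq.
Qed.

Lemma scc_of_refl i : scc_of A i i.
Proof. by split; exact: reach_refl. Qed.

Lemma eq_scc_of i j : scc_of A i j -> scc_of A i = scc_of A j.
Proof.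
move=> [ij ji]; apply/seteqP; split=> k [ik ki]; split.
- exact: reach_trans ji ik.
- exact: reach_trans ki ij.
- exact: reach_trans ij ik.
- exact: reach_trans ki ji.
Qed.

(** If [B] has the arcs of [A] and [p] is a path of the multigraph from the component of [k] to that
    of [i], this is the supremum of the weights of the paths from [k] to [i] whose
    component-changing arcs are exactly [p], in order. *)
Fixpoint scc_path_weight (B : S -> S -> \bar R) k (p : seq (S * S)) i :=
  if p is a :: q
  then mpstar B k a.1 + B a.1 a.2 + scc_path_weight B a.2 q i
  else mpstar B k i.

(** [B] stands for [mptilde A]: the shift keeps the arcs of [A], and [Bdiag] says that no circuit
    has positive weight. *)
Variable B : S -> S -> \bar R.
Hypothesis Bfin : forall i j, B i j != +oo.
Hypothesis arcB : Defs.arc B = Defs.arc A.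
Hypothesis Bdiag : forall n i, mppow B n i i <= 0.

Lemma reach_mppow i j : reach A i j -> exists n, mppow B n i j != -oo.
Proof.
move=> [p]; elim: p i => [|k p IHp] i /= [].
  by move=> _ ->; exists 0%N; rewrite [mppow B 0]/= mpid_refl.
move=> /andP[ik kp] pj; have [n kj] := IHp k (conj kp pj).
exists n.+1; rewrite -ltNye (lt_le_trans _ (mppowS_ge _ _ _ k _))//.
by move: ik; rewrite -arcB ltNye adde_eq_ninfty negb_or kj andbT.
Qed.

Lemma mpstar_scc_lty k i : scc_of A k i -> mpstar B k i < +oo.
Proof.
move=> [_ /reach_mppow[m ik]]; rewrite ltey; apply/eqP => kiy.
(* Returning from [i] to [k] in [m] arcs closes every path from [k] to [i] into a circuit. The
   return weight is not [-oo], so an infinite [mpstar B k i] would make this sum [+oo]. *)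
have : mpstar B k i + mppow B m i k <= 0.
  rewrite -ereal_supDr; apply/ereal_supP => _ [n _ <-].
  exact: le_trans (mppowD_ge _ _ _ _ _ _) (Bdiag _ _).
by rewrite kiy addye.
Qed.

(** Both ends of each [mpstar] term lie in one component, where [mpstar_scc_lty] applies. *)
Lemma scc_path_weight_lty k p i :
  scc_path A (scc_of A k) p (scc_of A i) -> scc_path_weight B k p i < +oo.
Proof.
elim: p k => [|a p IHp] k /= => [ki|[_ [[d ->] [_ ka da _]]]].
  by apply: mpstar_scc_lty; rewrite ki; exact: scc_of_refl.
rewrite (eq_scc_of da) => /IHp ap.
by rewrite lte_add_pinfty// lte_add_pinfty ?ltey// -ltey mpstar_scc_lty.
Qed.

(** Induction on the length [n] with [M] varying: removing a first arc from [k] to [j] of weight [b]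
    turns the bound [M] at [k] into [M - b] at [j]. *)
Lemma mppow_le_scc_path_weight (M : R) n k i :
  (forall p, scc_path A (scc_of A k) p (scc_of A i) ->
     scc_path_weight B k p i <= M%:E) ->
  mppow B n k i <= M%:E.
Proof.
elim: n k M => [|n IHn] k M kM.
  have [ki|ki] := pselect (k = i); last by rewrite [mppow B 0]/= mpid_neq// leNye.
  rewrite ki in kM *; apply: le_trans (kM [::] erefl).
  exact: mppow_le_mpstar.
rewrite mppowS; apply/ereal_supP => _ [j _ <-].
have := Bfin k j; case Bkj: (B k j) => [b| |] // _; last by rewrite addNye leNye.
rewrite addeC -leeBrDr// -EFinB; apply: IHn => p jp.
rewrite EFinB leeBrDr// addeC -Bkj.
have [kj|kj] := pselect (scc_of A k = scc_of A j).
  (* An arc inside a component is absorbed by the first [mpstar] term, and [p] is also a path from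
     the component of [k]. *)
  rewrite -kj in jp; apply: le_trans (kM p jp).
  case: p {jp} => [|a p] /=; first exact: mpstar_arc_le.
  by rewrite !addeA !leeD2r// mpstar_arc_le.
(* An arc leaving the component is prepended to [p]; the piece before it runs from [k] to [k], and
   the empty path gives it weight at least 0. *)
apply: le_trans (kM ((k, j) :: p) _) => /=.
  by rewrite leeD2r// leeDr// mpstar_refl_ge0.
exists (scc_of A j); split=> //; first by exists j.
split=> //; try exact: scc_of_refl.
by rewrite -arcB /Defs.arc Bkj.
Qed.

Lemma mpstar_lty k i : finitely_many_scc_paths A -> mpstar B k i < +oo.
Proof.
move=> finA; have [ki|ki] := pselect (scc_of A k = scc_of A i).
  by apply: mpstar_scc_lty; rewrite ki; exact: scc_of_refl.
have [|||M kM] := finite_set_lty_bounded (finA _ _ _ _ ki)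
    (f := fun p => scc_path_weight B k p i).
- by exists k.
- by exists i.
- by move=> p; exact: scc_path_weight_lty.
apply: le_lt_trans (ltry M); apply/ereal_supP => _ [n _ <-].
exact: mppow_le_scc_path_weight.
Qed.

End Components.

Theorem proposition5p1 (R : realType) (S : Type) (A : S -> S -> \bar R)
    (infS : infinite_set [set: S])
    (Afin : forall i j, A i j != +oo)
    (rhofin : max_circuit_mean A \is a fin_num) :
  (forall (lambda : R) (i : S), max_circuit_mean A <= lambda%:E ->
     let u := fun k => mpstar (mpshift A lambda) k i in
     (forall k, mpapp A u k = lambda%:E + u k) <->
     (recurrent A i /\ lambda%:E = max_circuit_mean A)) /\
  (finitely_many_scc_paths A -> forall i : S,
     mpeigenvector A (fine (max_circuit_mean A))
       (fun k => mpstar (mptilde A) k i) <->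
     recurrent A i).
Proof.
have Ar := esym (fineK rhofin); set r := fine _ in Ar.
have part1 l i : max_circuit_mean A <= l%:E ->
    let u := fun k => mpstar (mpshift A l) k i in
    (forall k, mpapp A u k = l%:E + u k) <->
    (recurrent A i /\ l%:E = max_circuit_mean A).
  rewrite {1}Ar lee_fin => rl u.
  apply: iff_trans (mpplus_mpshift_ge0P i Ar rl).
  apply: iff_trans (mpstar_column_fixedP _ _).
  (* Since [l] is finite, it can be moved across: [A u = l + u] is the fixed-point equation
     [A_l u = u]. *)
  rewrite /u; split=> Au k; have := Au k; rewrite mpapp_mpshift.
    by move=> ->; rewrite addeAC subee// add0e.
  by move=> <-; rewrite addeC subeK.
split=> // finA i.
have rho_le : max_circuit_mean A <= r%:E by rewrite Ar.
split=> [[_ _ /(part1 _ _ rho_le)[]//]|reci].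
split.
- move=> k; rewrite -ltey; apply: mpstar_lty finA.
  + by move=> j h; rewrite /mptilde /mpshift; case: (A j h) (Afin j h).
  + exact: arc_mpshift.
  + move=> n j; rewrite (le_trans (mppow_mpshift_diag_le _ _ _ Ar))//.
    by rewrite subrr mul0rn.
- by exists i; rewrite -ltNye (lt_le_trans _ (mpstar_refl_ge0 _ _)).
- by apply/(part1 _ _ rho_le); rewrite Ar.
Qed.
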